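(* Let $A\subset\mathbb{N}^2$ and for $n\in\mathbb{N}$ let $A_n=\{m\in\mathbb{N}:(n,m)\in A\}$. Suppose that for some Følner sequence $\Phi$ in $\mathbb{N}$ one has $\limsup_{n\to\infty}\mathsf{d}_\Phi(A_n)>0$. Then there exist infinite sets $B,C\subset\mathbb{N}$ such that $\{(b,c): b\in B,\ c\in C,\ b<c\}\subset A$.
   Context: A Følner sequence in $\mathbb{N}$ is a sequence $(\Phi_N)_{N\in\mathbb{N}}$ of finite subsets of $\mathbb{N}$ with $|(\Phi_N+t)\cap\Phi_N|/|\Phi_N|\to1$ for all $t\in\mathbb{N}$. For $E\subset\mathbb{N}$, $\mathsf{d}_\Phi(E)=\lim_{N\to\infty}|E\cap\Phi_N|/|\Phi_N|$ denotes the density of $E$ along $\Phi$ (the hypothesis refers to these densities). *)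

(* Defs.v *)
From mathcomp Require Import all_boot all_order all_algebra finmap.
From mathcomp Require Import all_classical all_reals all_analysis.
Import Order.TTheory GRing.Theory Num.Theory.
Import numFieldNormedType.Exports.
Set Implicit Arguments.
Unset Strict Implicit.
Unset Printing Implicit Defensive.
Local Open Scope classical_set_scope.
Local Open Scope ring_scope.

(* Some [Phi N] may be empty, the quotient then being 0 since [x / 0 = 0] in R;
   the convergence to 1 allows this for finitely many [N] only. *)
Definition folner (R : realType) (Phi : nat -> {fset nat}) : Prop :=
  forall t : nat,
    (#|` ([fset (m + t)%N | m in Phi N] `&` Phi N)%fset|%:R / #|` Phi N|%:R : R)
      @[N --> \oo] --> (1 : R).

Definition rel_freq (R : realType) (Phi : nat -> {fset nat}) (E : set nat)
    (N : nat) : R :=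
  #|` [fset m in Phi N | m \in E]%fset|%:R / #|` Phi N|%:R.

Definition has_density (R : realType) (Phi : nat -> {fset nat})
    (E : set nat) : Prop :=
  cvgn (rel_freq R Phi E).

(* [density R Phi E] is only meaningful under [has_density R Phi E]. *)
Definition density (R : realType) (Phi : nat -> {fset nat}) (E : set nat) : R :=
  limn (rel_freq R Phi E).

(* Main.v *)
(* Fix an ultrafilter on the indices N refining convergence to infinity.  Given
   infinitely many sets S_i of relative frequency >= e, some S_i meets
   infinitely many S_j in relative frequency >= e' > 0, since by Bonferroni's
   inequality many almost disjoint sets of frequency >= e would have a union of
   frequency > 1.  Iterating inside E /\ S_i yields indices b_0 < b_1 < ... all
   of whose finite intersections have positive frequency; these intersections
   are infinite because the Folner condition makes finite sets negligible, so
   one may pick c_k in S_{b_0} /\ ... /\ S_{b_k} with b_k < c_k < b_{k+1}. *)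
Require Import Defs.
From mathcomp Require Import all_boot all_order all_algebra finmap.
From mathcomp Require Import all_classical all_reals all_analysis.
From mathcomp Require Import lra.
Import Order.TTheory GRing.Theory Num.Theory.
Import numFieldNormedType.Exports.
Local Open Scope classical_set_scope.
Local Open Scope ring_scope.

Lemma infinite_set_unbounded (S : set nat) :
  (forall n, exists2 m, (n <= m)%N & S m) -> infinite_set S.
Proof.
move=> Sub /finite_seqP[s sE].
have [m] := Sub (\max_(i <- s) i).+1; rewrite sE /= => + ms.
by rewrite ltnNge; case/negP; exact: leq_bigmax_seq.
Qed.

Lemma infinite_set_gt (S : set nat) (n : nat) :
  infinite_set S -> exists2 m, (n < m)%N & S m.
Proof.
move=> /infinite_setD/(_ (finite_II n.+1))/infinite_setN0[m [Sm /= mn]].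
by exists m => //; rewrite ltnNge; apply/negP.
Qed.

Section rel_freq.
Variables (R : realType) (Phi : nat -> {fset nat}).
Implicit Types (E F : set nat) (N : nat).

Lemma rel_freq_ge0 E N : 0 <= rel_freq R Phi E N.
Proof. by rewrite divr_ge0. Qed.

Lemma rel_freq_le1 E N : rel_freq R Phi E N <= 1.
Proof.
rewrite /rel_freq; have [->|Phi0] := eqVneq #|` Phi N| 0%N.
  by rewrite invr0 mulr0.
rewrite ler_pdivrMr ?ltr0n ?lt0n// mul1r ler_nat.
by apply: fsubset_leq_card; apply/fsubsetP => x; rewrite !inE => /andP[].
Qed.

Lemma rel_freq0 N : rel_freq R Phi set0 N = 0.
Proof.
rewrite /rel_freq (_ : [fset m in Phi N | m \in set0]%fset = fset0).
  by rewrite cardfs0 mul0r.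
by apply/fsetP => x; rewrite !inE in_set0 andbF.
Qed.

Lemma le_rel_freq E F N : E `<=` F -> rel_freq R Phi E N <= rel_freq R Phi F N.
Proof.
move=> EF; rewrite ler_wpM2r// ler_nat fsubset_leq_card//.
apply/fsubsetP => x; rewrite !inE => /andP[-> /=].
by rewrite !inE; exact: EF.
Qed.

Lemma rel_freqUI E F N :
  rel_freq R Phi (E `|` F) N + rel_freq R Phi (E `&` F) N =
  rel_freq R Phi E N + rel_freq R Phi F N.
Proof.
rewrite -!mulrDl -!natrD; congr (_%:R / _).
rewrite -[RHS]cardfsUI.
congr (_ + _)%N; congr (size (enum_fset _)); apply/fsetP => x;
  by rewrite !inE ?in_setU ?in_setI; case: (x \in Phi N).
Qed.

(** A nonempty [Phi N] is not contained in its translate by 1, so the overlap [K] misses at least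
    one of its points. As the missed proportion is below [e / (#|X| + 1)], this forces
    [#|Phi N| > (#|X| + 1) / e], which makes [X] negligible. *)
Lemma folner_finite_rel_freq E (e : R) :
  folner R Phi -> finite_set E -> 0 < e ->
  \forall N \near \oo, rel_freq R Phi E N < e.
Proof.
move=> hPhi /finite_fsetP[X ->] e0.
have cX : 0 < #|` X|%:R + 1 :> R by rewrite ltr_pwDr.
have : 1 - e / (#|` X|%:R + 1) < 1 by rewrite ltrBlDr ltrDl divr_gt0.
move=> /(cvgr_gt _ (hPhi 1%N)); apply: filterS => N.
set K := (_ `&` _)%fset; rewrite /rel_freq.
have [->|Phi0] := eqVneq #|` Phi N| 0%N; first by rewrite !invr0 !mulr0.
have KPhi : (#|` K| < #|` Phi N|)%N.
  apply: fproper_ltn_card; rewrite fproperE fsubsetIr /=; apply/negP => PhiK.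
  (* Descent: 0 is no successor, and [m.+1] in [Phi N] would put [m] there too. *)
  have Phi_empty m : m \notin Phi N.
    elim: m => [|m IHm]; apply/negP => /(fsubsetP PhiK); rewrite in_fsetI;
      case/andP => /imfsetP[/= x xPhi]; rewrite addn1 // => -[mx] _.
    by move: IHm; rewrite mx xPhi.
  by move/negP: Phi0; rewrite cardfs_eq0; apply; apply/eqP/fsetP => m;
    rewrite in_fset0; apply/negbTE.
have P0 : 0 < #|` Phi N|%:R :> R by rewrite ltr0n lt0n.
rewrite ltr_pdivlMr// => ratio; rewrite ltr_pdivrMr//.
have : #|` K|%:R + 1 <= #|` Phi N|%:R :> R by rewrite natr1 ler_nat.
have : #|` [fset m in Phi N | m \in [set` X]]%fset|%:R <= #|` X|%:R :> R.
  rewrite ler_nat fsubset_leq_card//.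
  by apply/fsubsetP => x; rewrite !inE => /andP[_]; rewrite mem_setE.
have : e / (#|` X|%:R + 1) * (#|` X|%:R + 1) = e by rewrite divfK// gt_eqF.
move: ratio; set d := e / _; set x : R := #|` X|%:R; set p : R := #|` Phi N|%:R.
move=> ratio <- yx Kp; nra.
Qed.

Lemma density_le1 E : has_density R Phi E -> density R Phi E <= 1.
Proof.
by move=> dE; apply: limr_le => //; apply: nearW => N; exact: rel_freq_le1.
Qed.

Lemma density_ge0 E : has_density R Phi E -> 0 <= density R Phi E.
Proof.
by move=> dE; apply: limr_ge => //; apply: nearW => N; exact: rel_freq_ge0.
Qed.

End rel_freq.

Lemma limn_sup_gt_infinite (R : realType) (u : nat -> R) (e : R) :
  bounded_fun (u : nat -> R^o) -> e < limn_sup u ->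
  infinite_set [set n | e < u n].
Proof.
move=> bu eu; apply: infinite_set_unbounded => n.
have ub := bounded_fun_has_ubound bu.
have : e < sups u n.
  apply: (lt_le_trans eu); apply: nonincreasing_cvgn_ge.
    exact: nonincreasing_sups.
  apply/cvg_ex; eexists; apply: cvg_sups_inf => //.
  exact: bounded_fun_has_lbound.
by case/sup_gt => [|_ [m /= nm <-] em]; [exists (u n); exists n => /= | exists m].
Qed.

(** Invariant of the iteration. Lower bounds along [U] stand in for densities, which the successive
    intersections need not possess. *)
Definition recurrent (R : realType) (Phi : nat -> {fset nat})
    (U : set_system nat) (S : nat -> set nat) (E : set nat) : Prop :=
  exists2 e : R, 0 < e &
    infinite_set [set i | \forall N \near U, e <= rel_freq R Phi (E `&` S i) N].

Section recurrent.
Variables (R : realType) (Phi : nat -> {fset nat}) (U : set_system nat).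
Context {UU : UltraFilter U}.
Implicit Types (S : nat -> set nat) (E : set nat).

(** Induction on [M]: adjoin to [W] some [X i] with [i] outside the finite exceptional set of [W].
    Each step gains at least [e - M d], and the losses total at most [M ^ 2 d]. The second
    conclusion keeps the induction going: the exceptional set of the new [W] lies in the union of
    those of the old [W] and of [X i]. *)
Lemma almost_disjoint_union (X : nat -> set nat) (I : set nat) (e d : R) M :
  infinite_set I -> 0 <= d ->
  (forall i, I i -> \forall N \near U, e <= rel_freq R Phi (X i) N) ->
  (forall i, I i -> finite_set
    (I `&` [set j | ~ \forall N \near U, rel_freq R Phi (X i `&` X j) N <= d])) ->
  exists W : set nat,
    (\forall N \near U, M%:R * e - M%:R ^+ 2 * d <= rel_freq R Phi W N) /\
    finite_set (I `&`
      [set j | ~ \forall N \near U, rel_freq R Phi (W `&` X j) N <= M%:R * d]).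
Proof.
move=> infI d0 Xe Xd; elim: M => [|M [W [We Wd]]].
  exists set0; split.
    by apply: nearW => N; rewrite rel_freq0 mulr0n expr0n !mul0r subr0.
  rewrite (_ : _ `&` _ = set0)//; apply/seteqP; split => // j [_ /=]; apply.
  by apply: nearW => N; rewrite set0I rel_freq0 mul0r.
have [i [Ii /not_andP[//|/contrapT Wi]]] := infinite_setN0 (infinite_setD infI Wd).
exists (W `|` X i); split.
  near=> N.
  have We' : M%:R * e - M%:R ^+ 2 * d <= rel_freq R Phi W N by near: N.
  have Xi : e <= rel_freq R Phi (X i) N by near: N; exact: Xe.
  have WXi : rel_freq R Phi (W `&` X i) N <= M%:R * d by near: N.
  have := rel_freqUI R Phi W (X i) N; rewrite -natr1.
  have Md : 0 <= M%:R * d :> R by rewrite mulr_ge0.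
  set m : R := M%:R in We' WXi Md *; nra.
have := conj Wd (Xd i Ii); rewrite -finite_setU.
apply: sub_finite_set => j [Ij /= nj].
apply: contrapT => /not_orP[/not_andP[//|/contrapT Wj] /not_andP[//|/contrapT Xj]].
apply: nj; near=> N.
have Wj' : rel_freq R Phi (W `&` X j) N <= M%:R * d by near: N.
have Xj' : rel_freq R Phi (X i `&` X j) N <= d by near: N.
have := rel_freqUI R Phi (W `&` X j) (X i `&` X j) N; rewrite -setIUl.
have := rel_freq_ge0 R Phi (W `&` X j `&` (X i `&` X j)) N.
rewrite -natr1; lra.
Unshelve. all: by end_near. Qed.

Lemma recurrent_step S E k : recurrent R Phi U S E ->
  exists2 i, (k < i)%N & recurrent R Phi U S (E `&` S i).
Proof.
move=> [e e0 infI]; set I := [set i | _] in infI.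
pose J := I `&` [set i | (k < i)%N].
have infJ : infinite_set J.
  apply: infinite_set_unbounded => n.
  have [m] := infinite_set_gt _ (maxn n k) infI.
  rewrite gtn_max => /andP[nm km] Im.
  by exists m; [exact: ltnW | split].
apply: contrapT => nstep.
(* With [M e > 2] and [d = 1 / M ^ 2], the bound [M e - M ^ 2 d] exceeds 1, which no relative
   frequency can do. *)
pose M := Num.bound (2 / e).
have Me : 2 < M%:R * e.
  by rewrite -ltr_pdivrMr // archi_boundP ?divr_ge0 ?ltW.
have M0 : 0 < M%:R :> R.
  by rewrite -(pmulr_lgt0 _ e0); exact: lt_trans Me.
pose d : R := M%:R ^- 2.
have d0 : 0 < d by rewrite invr_gt0 exprn_gt0.
have [|i []//|i Ji|W [We _]] :=
    almost_disjoint_union (fun i => E `&` S i) J e d M infJ.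
- exact: ltW.
- apply: contrapT => inf_i; apply: nstep; exists i; first by case: Ji.
  exists d => //; apply: contra_not inf_i; apply: sub_finite_set => j [Jj /=].
  (* The ultrafilter decides each frequency bound: for an exceptional [j], frequency below [d] along
     [U] is excluded, so frequency at least [d] holds along [U]. *)
  have [//|] := in_ultra_setVsetC
    [set N | d <= rel_freq R Phi (E `&` S i `&` S j) N] UU => nd []; apply: filterS nd.
  move=> N /= /negP; rewrite -ltNge => /ltW; apply: le_trans.
  by apply: le_rel_freq => x [[Ex Six] [_ Sjx]].
- have [N /=] := filter_ex We.
  have := rel_freq_le1 R Phi W N.
  by rewrite divff ?gt_eqF ?exprn_gt0//; lra.
Qed.

Lemma recurrent_infinite S E :
  folner R Phi -> nbhs \oo `<=` U -> recurrent R Phi U S E -> infinite_set E.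
Proof.
move=> hPhi sU [e e0 /infinite_setN0[i Ei]] finE.
have /sU fE := folner_finite_rel_freq R Phi E e hPhi finE e0.
have [N [/= eE Ee]] := filter_ex (filterI Ei fE).
have := le_rel_freq R Phi (E `&` S i) E N (@subIsetl _ _ _).
by rewrite leNgt (lt_le_trans Ee eE).
Qed.

Lemma recurrent_interleave S :
  (forall E, recurrent R Phi U S E -> infinite_set E) ->
  recurrent R Phi U S setT ->
  exists b c : nat -> nat,
    [/\ forall n, (b n < c n)%N, forall n, (c n < b n.+1)%N &
        forall i n, (i <= n)%N -> S (b i) (c n)].
Proof.
move=> rec_inf recT.
(* A state holds the current recurrent set and the last [c]; it is paired with the [b] that led to
   it. *)
pose state := {p : set nat * nat | recurrent R Phi U S p.1}.
pose next (x : state * nat) (y : state * nat) :=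
  [/\ ((sval x.1).2 < y.2 < (sval y.1).2)%N,
      (sval y.1).1 `<=` (sval x.1).1 `&` S y.2 &
      (sval y.1).1 (sval y.1).2].
have step x : {y | next x y}.
  apply: cid; case: x => -[[E c] /= recE] b0.
  have [b cb recb] := recurrent_step S E c recE.
  have [c' bc' Ec'] := infinite_set_gt _ b (rec_inf _ recb).
  exists (exist _ (E `&` S b, c') recb, b); split => //=.
  by rewrite cb.
(* The initial zeros are placeholders, hence the sequences are read off from [f n.+1]. *)
have [f [_ fS]] := dependent_choice step
  (exist _ ([set: nat], 0%N) recT, 0%N).
exists (fun n => (f n.+1).2), (fun n => (sval (f n.+1).1).2); split.
- by move=> n; have [/andP[]] := fS n.
- by move=> n; have [/andP[]] := fS n.+1.
move=> i n in_; have [_ _ cn] := fS n.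
(* The sets decrease, so [c n] lies in the one formed when [b i] was chosen, which is inside
   [S (b i)]. *)
have : (sval (f n.+1).1).1 `<=` (sval (f i.+1).1).1.
  rewrite -(subnKC in_); elim: (n - i)%N => [|k IH]; first by rewrite addn0.
  rewrite addnS; have [_ sub _] := fS (i + k).+1.
  by apply: subset_trans IH => x /sub[].
by have [_ sub _] := fS i => /(_ _ cn)/sub[].
Qed.

End recurrent.

Theorem theorem5p11 (R : realType) (A : set (nat * nat))
    (Phi : nat -> {fset nat})
    (hPhi : folner R Phi)
    (hdens : forall n : nat, has_density R Phi (xsection A n))
    (hlimsup : 0 < limn_sup (fun n : nat => density R Phi (xsection A n))) :
  exists B C : set nat,
    [/\ infinite_set B, infinite_set C &
        [set p : nat * nat | [/\ B p.1, C p.2 & (p.1 < p.2)%N]] `<=` A].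
Proof.
have [U [UU sU]] := ultraFilterLemma (_ : ProperFilter (nbhs \oo : set_system nat)).
have bdens : bounded_fun ((fun n => density R Phi (xsection A n)) : nat -> R^o).
  exists 1; split => // x x1 n _ /=.
  by rewrite ger0_norm ?density_ge0// (le_trans (density_le1 _ _ _ _)) ?ltW.
set L := limn_sup _ in hlimsup.
have L2 : L / 2 < L by lra.
(* Infinitely many sections have density above half the limsup; convergence turns this into a
   frequency bound for all large [N], hence along [U]. *)
have recT : recurrent R Phi U (xsection A) setT.
  exists (L / 2); first by lra.
  apply: sub_infinite_set (limn_sup_gt_infinite _ _ _ bdens L2) => n /= dn.
  rewrite setTI; apply: sU; exact: cvgr_ge (hdens n) _ dn.
have [b [c [bc cb bcA]]] := recurrent_interleave R Phi U (xsection A)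
  (fun E => recurrent_infinite R Phi U (xsection A) E hPhi sU) recT.
have b_incr : {homo b : i j / (i < j)%N}.
  by apply: homo_ltn => [? ? ? |n]; [exact: ltn_trans | exact: ltn_trans (cb n)].
have c_incr : {homo c : i j / (i < j)%N}.
  by apply: homo_ltn => [? ? ? |n]; [exact: ltn_trans | exact: ltn_trans (bc _)].
have incr_ge (g : nat -> nat) n : {homo g : i j / (i < j)%N} -> (n <= g n)%N.
  move=> g_incr; elim: n => // n IH; exact: leq_ltn_trans IH (g_incr _ _ _).
exists (range b), (range c); split.
- by apply: infinite_set_unbounded => n; exists (b n); [exact: incr_ge | exists n].
- by apply: infinite_set_unbounded => n; exists (c n); [exact: incr_ge | exists n].
move=> [_ _] [/= [i _ <-] [n _ <-]] bcin.
(* Were [n < i], then [c n < b n.+1 <= b i], against [b i < c n]. *)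
have in_ : (i <= n)%N.
  rewrite leqNgt; apply/negP => ni; move: bcin; rewrite ltnNge => /negP; apply.
  by apply: (leq_trans (ltnW (cb n))); exact: (ltnW_homo b_incr).
by have := bcA i n in_; rewrite /xsection /= inE.
Qed.
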